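(* Let $K$ be a field and let $X$ be a partially ordered set. There is an involution on $D(X,K)$ if and only if there is an involution on $X$.
   Context: For a field $K$ and a poset $X$, the incidence space $I(X,K)$ is the $K$-space of functions $f:X\times X\to K$ with $f(x,y)=0$ whenever $x\nleq y$. The finitary incidence algebra $FI(X,K)$ is the subspace of all $f\in I(X,K)$ such that for all $x\le y$ in $X$ there are only finitely many subintervals $[u,v]\subseteq[x,y]$ with $u\ne v$ and $f(u,v)\neq 0$. It is an associative unital $K$-algebra under convolution $(fg)(x,y)=\sum_{x\le z\le y}f(x,z)g(z,y)$, and the same formula makes $I(X,K)$ an $FI(X,K)$-bimodule. $D(X,K)=FI(X,K)(+)I(X,K)$ (the idealization) is the $K$-algebra $FI(X,K)\oplus I(X,K)$, elements written as columns $\begin{bmatrix}f\\ i\end{bmatrix}$, with multiplication $\begin{bmatrix}f\\ i\end{bmatrix}\begin{bmatrix}g\\ j\end{bmatrix}=\begin{bmatrix}fg\\ fj+ig\end{bmatrix}$. An involution on a poset $X$ is a bijection $\lambda:X\to X$ with $x\le y\Leftrightarrow\lambda(y)\le\lambda(x)$ and $\lambda\circ\lambda=\mathrm{id}_X$. An involution on a $K$-algebra $A$ is a $K$-linear anti-automorphism $\phi$ of $A$ with $\phi\circ\phi=\mathrm{id}_A$. *)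

(* Defs.v *)
From HB Require Import structures.
From mathcomp Require Import all_boot all_order all_algebra.
From mathcomp Require Import boolp classical_sets functions cardinality fsbigop.

Set Implicit Arguments.
Unset Strict Implicit.
Unset Printing Implicit Defensive.

Import Order.TTheory GRing.Theory.

Local Open Scope classical_set_scope.
Local Open Scope ring_scope.

Definition poset_involution d (X : porderType d) (lambda : X -> X) : Prop :=
  [/\ bijective lambda,
      forall x y, (x <= y)%O <-> (lambda y <= lambda x)%O &
      involutive lambda].

Section Convolution.
Context {K : fieldType} {d : Order.disp_t} {X : porderType d}.
Implicit Types f g h : X -> X -> K.

(* [\sum_(z \in A)] is the sum of a finitely supported family, and 0 when the
   support is infinite; the latter does not occur if f or g is finitary (see
   [conv_finl] and [conv_finr]). *)
Definition conv f g : X -> X -> K :=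
  fun x y => \sum_(z \in [set z | (x <= z <= y)%O]) f x z * g z y.

Definition delta : X -> X -> K := fun x y => (x == y)%:R.

Definition incident_pred : {pred X -> X -> K} :=
  fun f => `[< forall x y, ~~ (x <= y)%O -> f x y = 0 >].

(* A subinterval [u, v] of [x, y] is encoded by the pair of its end points,
   which it determines since u <= v. *)
Definition finitary f : Prop :=
  forall x y, (x <= y)%O ->
    finite_set [set uv : X * X | [/\ (x <= uv.1)%O, (uv.1 <= uv.2)%O,
      (uv.2 <= y)%O, uv.1 <> uv.2 & f uv.1 uv.2 <> 0]].

Lemma incidentP f :
  reflect (forall x y, ~~ (x <= y)%O -> f x y = 0) (f \in incident_pred).
Proof. exact: asboolP. Qed.

Lemma incident_neq0 f x y : f \in incident_pred -> f x y != 0 -> (x <= y)%O.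
Proof. by move=> /incidentP f0; apply: contra_neqT => /f0. Qed.

Lemma incident_zmod_closed : zmod_closed incident_pred.
Proof.
split=> [|f g /incidentP f0 /incidentP g0]; apply/incidentP => x y xy //.
by rewrite !fctE /= f0 // g0 // subr0.
Qed.

HB.instance Definition _ :=
  GRing.isZmodClosed.Build (X -> X -> K) incident_pred incident_zmod_closed.

Lemma incident_delta : delta \in incident_pred.
Proof.
by apply/incidentP => x y; rewrite /delta; case: eqP => // ->; rewrite lexx.
Qed.

Lemma incident_scale k f :
  f \in incident_pred -> (fun x y => k * f x y) \in incident_pred.
Proof. by move=> /incidentP f0; apply/incidentP => x y /f0 ->; rewrite mulr0. Qed.

Lemma incident_conv f g : conv f g \in incident_pred.
Proof.
apply/incidentP => x y xy; rewrite /conv fsbig1 // => z /= /andP[xz zy].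
by rewrite (le_trans xz zy) in xy.
Qed.

(* Sums over [x, y] can be computed over any finite set containing the
   support. *)
Lemma convE f g x y (S : set X) : f \in incident_pred -> g \in incident_pred ->
  (forall z, f x z * g z y != 0 -> S z) ->
  conv f g x y = \sum_(z \in S) f x z * g z y.
Proof.
move=> fI gI fgS; rewrite /conv.
transitivity (\sum_(z \in [set: X]) f x z * g z y); last first.
  apply/esym/fsbig_widen => // z [_] /= Sz; apply/eqP.
  by apply: contra_notT Sz => /fgS.
apply: fsbig_widen => // z [_] /= xzy; apply/eqP; apply: contra_notT xzy.
by rewrite mulf_eq0 negb_or => /andP[/(incident_neq0 fI)-> /(incident_neq0 gI)].
Qed.

Definition lfinite f := forall x y, finite_set [set z | f x z != 0 /\ (z <= y)%O].
Definition rfinite f := forall x y, finite_set [set z | f z y != 0 /\ (x <= z)%O].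

Lemma finitary_lfinite f : f \in incident_pred -> finitary f -> lfinite f.
Proof.
move=> fI ff x y; have [xy|xy] := boolP (x <= y)%O; last first.
  apply: (@sub_finite_set _ _ set0) => // z /= [/(incident_neq0 fI) xz zy].
  by rewrite (le_trans xz zy) in xy.
apply: (@sub_finite_set _ _
  ([set x] `|` snd @` [set uv : X * X | [/\ (x <= uv.1)%O, (uv.1 <= uv.2)%O,
      (uv.2 <= y)%O, uv.1 <> uv.2 & f uv.1 uv.2 <> 0]])).
  move=> z /= [fz zy]; have [->|xz] := eqVneq z x; [by left | right].
  exists (x, z) => //=; split => //; first exact: (incident_neq0 fI fz).
    by move=> e; rewrite e eqxx in xz.
  exact/eqP.
by rewrite finite_setU; split; [exact: finite_set1 | exact/finite_image/ff].
Qed.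

Lemma finitary_rfinite f : f \in incident_pred -> finitary f -> rfinite f.
Proof.
move=> fI ff x y; have [xy|xy] := boolP (x <= y)%O; last first.
  apply: (@sub_finite_set _ _ set0) => // z /= [/(incident_neq0 fI) zy xz].
  by rewrite (le_trans xz zy) in xy.
apply: (@sub_finite_set _ _
  ([set y] `|` fst @` [set uv : X * X | [/\ (x <= uv.1)%O, (uv.1 <= uv.2)%O,
      (uv.2 <= y)%O, uv.1 <> uv.2 & f uv.1 uv.2 <> 0]])).
  move=> z /= [fz xz]; have [->|zy] := eqVneq z y; [by left | right].
  exists (z, y) => //=; split => //; first exact: (incident_neq0 fI fz).
    by move=> e; rewrite e eqxx in zy.
  exact/eqP.
by rewrite finite_setU; split; [exact: finite_set1 | exact/finite_image/ff].
Qed.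

Lemma conv_finl f g x y : f \in incident_pred -> g \in incident_pred ->
  finitary f -> finite_set [set z | f x z * g z y != 0].
Proof.
move=> fI gI /(finitary_lfinite fI)/(_ x y); apply: sub_finite_set => z /=.
by rewrite mulf_eq0 negb_or => /andP[fz /(incident_neq0 gI)].
Qed.

Lemma conv_finr f g x y : f \in incident_pred -> g \in incident_pred ->
  finitary g -> finite_set [set z | f x z * g z y != 0].
Proof.
move=> fI gI /(finitary_rfinite gI)/(_ x y); apply: sub_finite_set => z /=.
by rewrite mulf_eq0 negb_or => /andP[/(incident_neq0 fI)].
Qed.

Lemma conv1f f : f \in incident_pred -> conv delta f = f.
Proof.
move=> fI; apply/funext => x; apply/funext => y.
rewrite (@convE _ _ _ _ [set x]) ?incident_delta // => [|z /=].
  by rewrite fsbig_set1 /delta eqxx mul1r.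
by rewrite /delta; case: (x =P z) => [->|]; rewrite ?mul0r ?eqxx.
Qed.

Lemma convf1 f : f \in incident_pred -> conv f delta = f.
Proof.
move=> fI; apply/funext => x; apply/funext => y.
rewrite (@convE _ _ _ _ [set y]) ?incident_delta // => [|z /=].
  by rewrite fsbig_set1 /delta eqxx mulr1.
by rewrite /delta; case: (z =P y) => [->|]; rewrite ?mulr0 ?eqxx.
Qed.

Lemma conv_scalel k f g : (fun x y => k * conv f g x y)
  = conv (fun x y => k * f x y) g.
Proof.
apply/funext => x; apply/funext => y; rewrite /conv mulr_fsumr.
by under eq_fsbigr do rewrite mulrA.
Qed.

Lemma conv_scaler k f g : (fun x y => k * conv f g x y)
  = conv f (fun x y => k * g x y).
Proof.
apply/funext => x; apply/funext => y; rewrite /conv mulr_fsumr.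
by under eq_fsbigr do rewrite mulrCA.
Qed.

Lemma convDl f f' g : f \in incident_pred -> f' \in incident_pred ->
    g \in incident_pred -> finitary f /\ finitary f' \/ finitary g ->
  conv (f + f') g = conv f g + conv f' g.
Proof.
move=> fI f'I gI fin; apply/funext => x; apply/funext => y; rewrite !fctE /=.
pose S := [set z | f x z * g z y != 0] `|` [set z | f' x z * g z y != 0].
have Sfin : finite_set S.
  by rewrite finite_setU; case: fin => [[]|] *;
    split; by [exact: conv_finl | exact: conv_finr].
rewrite (@convE f g _ _ S) // ?(@convE f' g _ _ S) //; try by move=> z; by [left|right].
rewrite -fsbig_split // (@convE _ _ _ _ S) ?rpredD //= => [|z].
  by apply: eq_fsbigr => z _; rewrite !fctE mulrDl.
rewrite !fctE mulrDl /S /= => fz.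
have [fz0|] := eqVneq (f x z * g z y) 0; last by left.
by right; move: fz; rewrite fz0 add0r.
Qed.

Lemma convDr f g g' : f \in incident_pred -> g \in incident_pred ->
    g' \in incident_pred -> finitary f \/ finitary g /\ finitary g' ->
  conv f (g + g') = conv f g + conv f g'.
Proof.
move=> fI gI g'I fin; apply/funext => x; apply/funext => y; rewrite !fctE /=.
pose S := [set z | f x z * g z y != 0] `|` [set z | f x z * g' z y != 0].
have Sfin : finite_set S.
  by rewrite finite_setU; case: fin => [|[]] *;
    split; by [exact: conv_finl | exact: conv_finr].
rewrite (@convE f g _ _ S) // ?(@convE f g' _ _ S) //; try by move=> z; by [left|right].
rewrite -fsbig_split // (@convE _ _ _ _ S) ?rpredD //= => [|z].
  by apply: eq_fsbigr => z _; rewrite !fctE mulrDr.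
rewrite !fctE mulrDr /S /= => fz.
have [fz0|] := eqVneq (f x z * g z y) 0; last by left.
by right; move: fz; rewrite fz0 add0r.
Qed.

Lemma convA_aux f g h x y (S : set X) : f \in incident_pred ->
    g \in incident_pred -> h \in incident_pred -> finite_set S ->
    (forall w z, f x w * g w z * h z y != 0 -> S w /\ S z) ->
  conv f (conv g h) x y = conv (conv f g) h x y.
Proof.
move=> fI gI hI Sfin SP.
have supp (F : X -> K) (A : set X) (k : K) :
    \sum_(w \in A) F w * k != 0 -> exists w, F w * k != 0.
  by move=> /(fsbigN1 (f := fun _ : unit => fun w => F w * k) (x := tt))[w]; exists w.
have suppl (F : X -> K) (A : set X) (k : K) :
    \sum_(w \in A) k * F w != 0 -> exists w, k * F w != 0.
  by move=> /(fsbigN1 (f := fun _ : unit => fun w => k * F w) (x := tt))[w]; exists w.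
have fsbig_S (F : X -> K) (P : set X) :
    (forall z, F z != 0 -> P z) -> (forall z, F z != 0 -> S z) ->
    \sum_(z \in P) F z = \sum_(z \in S) F z.
  move=> FP FS; transitivity (\sum_(z \in [set: X]) F z).
    apply: fsbig_widen => // z [_] /= Pz; apply/eqP.
    by apply: contra_notT Pz => /FP.
  apply/esym/fsbig_widen => // z [_] /= Sz; apply/eqP.
  by apply: contra_notT Sz => /FS.
have gh w : f x w * conv g h w y = \sum_(z \in S) f x w * g w z * h z y.
  rewrite /conv mulr_fsumr; under eq_fsbigr do rewrite mulrA.
  apply: fsbig_S => z /=; last by move=> /SP[].
  rewrite !mulf_eq0 !negb_or => /andP[/andP[_]].
  by move=> /(incident_neq0 gI) -> /(incident_neq0 hI).
have fg z : conv f g x z * h z y = \sum_(w \in S) f x w * g w z * h z y.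
  rewrite /conv mulr_fsuml; apply: fsbig_S => w /=; last by move=> /SP[].
  rewrite !mulf_eq0 !negb_or => /andP[/andP[]].
  by move=> /(incident_neq0 fI) -> /(incident_neq0 gI).
rewrite (@convE f _ _ _ S) ?incident_conv //; last first.
  move=> w; rewrite /conv mulr_fsumr => /suppl[z].
  by rewrite mulrA => /SP[].
rewrite (@convE _ h _ _ S) ?incident_conv //; last first.
  by move=> z; rewrite /conv mulr_fsuml => /supp[w] /SP[].
under eq_fsbigr do rewrite gh; under [RHS]eq_fsbigr do rewrite fg.
exact: exchange_fsbig.
Qed.

Lemma convA f g h : f \in incident_pred -> g \in incident_pred ->
    h \in incident_pred ->
    [\/ finitary f /\ finitary g, finitary f /\ finitary h |
        finitary g /\ finitary h] ->
  conv f (conv g h) = conv (conv f g) h.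
Proof.
move=> fI gI hI fin; apply/funext => x; apply/funext => y.
have neq0 w z : f x w * g w z * h z y != 0 ->
    [/\ f x w != 0, g w z != 0, h z y != 0 &
        [/\ (x <= w)%O, (w <= z)%O, (z <= y)%O, (x <= z)%O & (w <= y)%O]].
  rewrite !mulf_eq0 !negb_or => /andP[/andP[f0 g0] h0].
  have xw := incident_neq0 fI f0; have wz := incident_neq0 gI g0.
  have zy := incident_neq0 hI h0.
  by split => //; split => //; [exact: le_trans xw wz | exact: le_trans wz zy].
case: fin => -[].
- move=> /(finitary_lfinite fI) fl /(finitary_lfinite gI) gl.
  pose S1 := [set w | f x w != 0 /\ (w <= y)%O].
  apply: (@convA_aux _ _ _ _ _
    (S1 `|` \bigcup_(w in S1) [set z | g w z != 0 /\ (z <= y)%O])) => //.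
    by rewrite finite_setU; split; [exact: fl | apply: bigcup_finite => [|w _]; [exact: fl | exact: gl]].
  move=> w z /neq0[f0 g0 h0 [xw wz zy xz wy]]; split; first by left.
  by right; exists w.
- move=> /(finitary_lfinite fI) fl /(finitary_rfinite hI) hr.
  apply: (@convA_aux _ _ _ _ _ ([set w | f x w != 0 /\ (w <= y)%O] `|`
    [set z | h z y != 0 /\ (x <= z)%O])) => //.
    by rewrite finite_setU; split; [exact: fl | exact: hr].
  by move=> w z /neq0[f0 g0 h0 [xw wz zy xz wy]]; split; [left | right].
- move=> /(finitary_rfinite gI) gr /(finitary_rfinite hI) hr.
  pose S1 := [set z | h z y != 0 /\ (x <= z)%O].
  apply: (@convA_aux _ _ _ _ _
    (S1 `|` \bigcup_(z in S1) [set w | g w z != 0 /\ (x <= w)%O])) => //.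
    by rewrite finite_setU; split; [exact: hr | apply: bigcup_finite => [|z _]; [exact: hr | exact: gr]].
  move=> w z /neq0[f0 g0 h0 [xw wz zy xz wy]]; split; last by left.
  by right; exists z.
Qed.

Lemma finitary_delta : finitary delta.
Proof.
move=> x y _; apply: (@sub_finite_set _ _ set0) => // -[u v] /= [_ _ _ uv].
by rewrite /delta; case: eqP.
Qed.

Lemma finitary0 : finitary 0.
Proof. by move=> x y _; apply: (@sub_finite_set _ _ set0) => // -[u v] /= []. Qed.

Lemma finitary_lin k f g : finitary f -> finitary g ->
  finitary (fun x y => k * f x y + g x y).
Proof.
move=> ff gf x y xy; move: (ff x y xy) (gf x y xy) => ffxy gfxy.
pose S (f : X -> X -> K) := [set uv : X * X | [/\ (x <= uv.1)%O,
  (uv.1 <= uv.2)%O, (uv.2 <= y)%O, uv.1 <> uv.2 & f uv.1 uv.2 <> 0]].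
apply: (@sub_finite_set _ _ (S f `|` S g)); last by rewrite finite_setU.
move=> [u v] /= [xu uv vy nuv fguv].
have [f0|f0] := pselect (f u v = 0); last by left.
right; split=> //= g0; apply: fguv.
by rewrite f0 g0 mulr0 addr0.
Qed.

Lemma finitary_conv f g : f \in incident_pred -> g \in incident_pred ->
  finitary f -> finitary g -> finitary (conv f g).
Proof.
move=> fI gI ff gf x y xy; move: (ff x y xy) (gf x y xy) => ffxy gfxy.
pose S (f : X -> X -> K) := [set uv : X * X | [/\ (x <= uv.1)%O,
  (uv.1 <= uv.2)%O, (uv.2 <= y)%O, uv.1 <> uv.2 & f uv.1 uv.2 <> 0]].
apply: (@sub_finite_set _ _ (S f `|` (S g `|`
    [set (u, v) | u in fst @` S f & v in snd @` S g]))); last first.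
  rewrite !finite_setU; split; [exact: ffxy | split; first exact: gfxy].
  by apply: finite_image2; exact: finite_image.
move=> [u v] /= [xu uv vy nuv /eqP].
move=> /(fsbigN1 (f := fun _ : unit => fun z => f u z * g z v) (x := tt))[z /=].
move=> /andP[uz zv]; rewrite mulf_eq0 negb_or => /andP[/eqP f0 /eqP g0].
have [zu|/eqP zu] := eqVneq z u; first by right; left; subst z; split.
have [zv'|/eqP zv'] := eqVneq z v; first by left; subst z; split.
right; right; exists u; last exists v => //.
  exists (u, z) => //; split => //=; first exact: le_trans zv vy.
  by move=> e; apply: zu.
by exists (z, v) => //; split => //=; exact: le_trans xu uz.
Qed.

End Convolution.

Record incspace (K : fieldType) (d : Order.disp_t) (X : porderType d) :=
  IncSpace { incfun :> X -> X -> K; _ : incfun \in incident_pred }.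

Section IncidenceSpace.
Context {K : fieldType} {d : Order.disp_t} {X : porderType d}.

HB.instance Definition _ := [isSub for @incfun K d X].
HB.instance Definition _ := [Choice of incspace K X by <:].
HB.instance Definition _ := [SubChoice_isSubZmodule of incspace K X by <:].

Lemma incfunP (f : incspace K X) : (f : X -> X -> K) \in incident_pred.
Proof. exact: valP. Qed.

Lemma incspaceP (f g : incspace K X) : (forall x y, f x y = g x y) -> f = g.
Proof.
by move=> fg; apply/val_inj/funext => x; apply/funext => y; exact: fg.
Qed.

Definition inc_scale (k : K) (f : incspace K X) : incspace K X :=
  IncSpace (incident_scale k (incfunP f)).

Lemma inc_scaleA a b f : inc_scale a (inc_scale b f) = inc_scale (a * b) f.
Proof. by apply: incspaceP => x y; rewrite /= mulrA. Qed.
Lemma inc_scale1 : left_id 1 inc_scale.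
Proof. by move=> f; apply: incspaceP => x y; rewrite /= mul1r. Qed.
Lemma inc_scaleDr : right_distributive inc_scale +%R.
Proof. by move=> k f g; apply: incspaceP => x y; exact: mulrDr. Qed.
Lemma inc_scaleDl f : {morph inc_scale^~ f : a b / a + b}.
Proof. by move=> a b; apply: incspaceP => x y; exact: mulrDl. Qed.

HB.instance Definition _ := GRing.Zmodule_isLmodule.Build K (incspace K X)
  inc_scaleA inc_scale1 inc_scaleDr inc_scaleDl.

Definition finitary_pred : {pred incspace K X} := fun f => `[< finitary f >].

Lemma finitary_submod_closed : submod_closed finitary_pred.
Proof.
split=> [|k f g /asboolP ff /asboolP gf]; apply/asboolP; first exact: finitary0.
exact: finitary_lin.
Qed.

HB.instance Definition _ :=
  GRing.isSubmodClosed.Build K (incspace K X) finitary_pred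
    finitary_submod_closed.

End IncidenceSpace.

Record fincalg (K : fieldType) (d : Order.disp_t) (X : porderType d) :=
  FIncAlg { finc :> incspace K X; _ : finc \in finitary_pred }.

Section FinitaryIncidenceAlgebra.
Context {K : fieldType} {d : Order.disp_t} {X : porderType d}.
Local Notation I := (incspace K X).
Local Notation FI := (fincalg K X).

HB.instance Definition _ := [isSub for @finc K d X].
HB.instance Definition _ := [Choice of FI by <:].
HB.instance Definition _ := [SubChoice_isSubLmodule of FI by <:].

Lemma fincP (f : FI) : finitary f.
Proof. by case: f => f /= /asboolP. Qed.

Lemma fincalgP (f g : FI) : (forall x y, f x y = g x y) -> f = g.
Proof. by move=> fg; apply/val_inj/incspaceP. Qed.

Definition inc_conv (f g : I) : I := IncSpace (incident_conv f g).

Definition inc_lact (f : FI) (i : I) : I := inc_conv f i.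
Definition inc_ract (i : I) (f : FI) : I := inc_conv i f.

Lemma finc_one_subproof : IncSpace incident_delta \in @finitary_pred K d X.
Proof. exact/asboolP/finitary_delta. Qed.

Lemma finc_mul_subproof (f g : FI) : inc_conv f g \in finitary_pred.
Proof.
by apply/asboolP/finitary_conv; [exact: incfunP.. | exact: fincP | exact: fincP].
Qed.

Definition finc_one : FI := FIncAlg finc_one_subproof.
Definition finc_mul (f g : FI) : FI := FIncAlg (finc_mul_subproof f g).

Lemma inc_lactA (f g : FI) (i : I) :
  inc_lact f (inc_lact g i) = inc_lact (finc_mul f g) i.
Proof.
apply/val_inj/convA; [exact: incfunP.. |].
by constructor 1; split; exact: fincP.
Qed.
Lemma inc_lractA (f : FI) (i : I) (g : FI) :
  inc_lact f (inc_ract i g) = inc_ract (inc_lact f i) g.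
Proof.
apply/val_inj/convA; [exact: incfunP.. |].
by constructor 2; split; exact: fincP.
Qed.
Lemma inc_ractA (i : I) (f g : FI) :
  inc_ract i (finc_mul f g) = inc_ract (inc_ract i f) g.
Proof.
apply/val_inj/convA; [exact: incfunP.. |].
by constructor 3; split; exact: fincP.
Qed.
Lemma inc_lact1 (i : I) : inc_lact finc_one i = i.
Proof. exact/val_inj/conv1f/incfunP. Qed.
Lemma inc_ract1 (i : I) : inc_ract i finc_one = i.
Proof. exact/val_inj/convf1/incfunP. Qed.
Lemma inc_lactDl (f g : FI) (i : I) :
  inc_lact (f + g) i = inc_lact f i + inc_lact g i.
Proof.
apply: val_inj; exact: (@convDl _ _ _ f g i (incfunP _) (incfunP _) (incfunP _)
  (or_introl (conj (fincP f) (fincP g)))).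
Qed.
Lemma inc_lactDr (f : FI) (i j : I) :
  inc_lact f (i + j) = inc_lact f i + inc_lact f j.
Proof.
apply: val_inj; exact: (@convDr _ _ _ f i j (incfunP _) (incfunP _) (incfunP _)
  (or_introl (fincP f))).
Qed.
Lemma inc_ractDl (i j : I) (f : FI) :
  inc_ract (i + j) f = inc_ract i f + inc_ract j f.
Proof.
apply: val_inj; exact: (@convDl _ _ _ i j f (incfunP _) (incfunP _) (incfunP _)
  (or_intror (fincP f))).
Qed.
Lemma inc_ractDr (i : I) (f g : FI) :
  inc_ract i (f + g) = inc_ract i f + inc_ract i g.
Proof.
apply: val_inj; exact: (@convDr _ _ _ i f g (incfunP _) (incfunP _) (incfunP _)
  (or_intror (conj (fincP f) (fincP g)))).
Qed.
Lemma inc_lactZl (k : K) (f : FI) (i : I) :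
  k *: inc_lact f i = inc_lact (k *: f) i.
Proof.
apply: val_inj; exact: (conv_scalel k f i).
Qed.
Lemma inc_lactZr (k : K) (f : FI) (i : I) :
  k *: inc_lact f i = inc_lact f (k *: i).
Proof.
apply: val_inj; exact: (conv_scaler k f i).
Qed.
Lemma inc_ractZl (k : K) (i : I) (f : FI) :
  k *: inc_ract i f = inc_ract (k *: i) f.
Proof.
apply: val_inj; exact: (conv_scalel k i f).
Qed.
Lemma inc_ractZr (k : K) (i : I) (f : FI) :
  k *: inc_ract i f = inc_ract i (k *: f).
Proof.
apply: val_inj; exact: (conv_scaler k i f).
Qed.

Lemma finc_mulA : associative finc_mul.
Proof. by move=> f g h; apply: val_inj; exact: inc_lactA. Qed.
Lemma finc_mul1l : left_id finc_one finc_mul.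
Proof. by move=> f; apply: val_inj; exact: inc_lact1. Qed.
Lemma finc_mul1r : right_id finc_one finc_mul.
Proof. by move=> f; apply: val_inj; exact: inc_ract1. Qed.
Lemma finc_mulDl : left_distributive finc_mul +%R.
Proof. by move=> f g h; apply: val_inj; exact: inc_lactDl. Qed.
Lemma finc_mulDr : right_distributive finc_mul +%R.
Proof. by move=> f g h; apply: val_inj; exact: inc_lactDr. Qed.

HB.instance Definition _ := GRing.Zmodule_isPzRing.Build FI
  finc_mulA finc_mul1l finc_mul1r finc_mulDl finc_mulDr.

Lemma finc_scaleAl (k : K) (f g : FI) : k *: (f * g) = (k *: f) * g.
Proof. by apply: val_inj; exact: inc_lactZl. Qed.
Lemma finc_scaleAr (k : K) (f g : FI) : k *: (f * g) = f * (k *: g).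
Proof. by apply: val_inj; exact: inc_lactZr. Qed.

End FinitaryIncidenceAlgebra.

Definition idealization (K : fieldType) (d : Order.disp_t)
  (X : porderType d) : Type := (fincalg K X * incspace K X)%type.

Section Idealization.
Context {K : fieldType} {d : Order.disp_t} {X : porderType d}.
Local Notation D := (idealization K X).

HB.instance Definition _ :=
  GRing.Lmodule.copy D (fincalg K X * incspace K X)%type.

Definition ideal_one : D := (1, 0).
Definition ideal_mul (a b : D) : D :=
  (a.1 * b.1, inc_lact a.1 b.2 + inc_ract a.2 b.1).

Lemma inc_lact0 (f : fincalg K X) : inc_lact f (0 : incspace K X) = 0.
Proof. by apply: (addrI (inc_lact f 0)); rewrite -inc_lactDr !addr0. Qed.
Lemma inc_ract0 (f : fincalg K X) : inc_ract (0 : incspace K X) f = 0.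
Proof. by apply: (addrI (inc_ract 0 f)); rewrite -inc_ractDl !addr0. Qed.

Lemma ideal_mulA : associative ideal_mul.
Proof.
move=> [f i] [g j] [h k]; rewrite /ideal_mul /= mulrA; congr pair.
by rewrite inc_lactDr inc_ractDl inc_lactA inc_lractA inc_ractA addrA.
Qed.
Lemma ideal_mul1l : left_id ideal_one ideal_mul.
Proof.
by move=> [f i]; rewrite /ideal_mul /= mul1r inc_lact1 inc_ract0 addr0.
Qed.
Lemma ideal_mul1r : right_id ideal_one ideal_mul.
Proof.
by move=> [f i]; rewrite /ideal_mul /= mulr1 inc_ract1 inc_lact0 add0r.
Qed.
Lemma ideal_mulDl : left_distributive ideal_mul +%R.
Proof.
move=> [f i] [g j] [h k]; rewrite /ideal_mul /=; congr pair; first exact: mulrDl.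
by rewrite inc_lactDl inc_ractDl addrACA.
Qed.
Lemma ideal_mulDr : right_distributive ideal_mul +%R.
Proof.
move=> [f i] [g j] [h k]; rewrite /ideal_mul /=; congr pair; first exact: mulrDr.
by rewrite inc_lactDr inc_ractDr addrACA.
Qed.

HB.instance Definition _ := GRing.Zmodule_isPzRing.Build D
  ideal_mulA ideal_mul1l ideal_mul1r ideal_mulDl ideal_mulDr.

(* [ideal_scaleAl] and [ideal_scaleAr] make D(X, K) a K-algebra; it is not
   declared as an [algType K], which is restricted to nontrivial rings, because
   D(X, K) is the zero ring when X is empty. *)
Lemma ideal_scaleAl (k : K) (a b : D) : k *: (a * b) = (k *: a) * b.
Proof.
case: a b => [f i] [g j].
have e : k *: (inc_lact f j + inc_ract i g) = inc_lact (k *: f) j + inc_ract (k *: i) g.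
  by rewrite scalerDr inc_lactZl inc_ractZl.
exact: (congr2 (fun u v => (u, v) : D) (finc_scaleAl k f g) e).
Qed.
Lemma ideal_scaleAr (k : K) (a b : D) : k *: (a * b) = a * (k *: b).
Proof.
case: a b => [f i] [g j].
have e : k *: (inc_lact f j + inc_ract i g) = inc_lact f (k *: j) + inc_ract i (k *: g).
  by rewrite scalerDr inc_lactZr inc_ractZr.
exact: (congr2 (fun u v => (u, v) : D) (finc_scaleAr k f g) e).
Qed.

Definition alg_anti_automorphism (phi : D -> D) : Prop :=
  [/\ linear phi, bijective phi, phi 1 = 1 &
      forall a b, phi (a * b) = phi b * phi a].

Definition alg_involution (phi : D -> D) : Prop :=
  alg_anti_automorphism phi /\ involutive phi.

End Idealization.

(* Main.v *)
Require Import Defs.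
From mathcomp Require Import all_boot all_order all_algebra.
From mathcomp Require Import boolp classical_sets functions cardinality fsbigop.

Set Implicit Arguments.
Unset Strict Implicit.
Unset Printing Implicit Defensive.

Import Order.TTheory GRing.Theory.

Local Open Scope classical_set_scope.
Local Open Scope ring_scope.

(** An involution [lambda] of X gives the involution of D(X, K) that sends each
    component f to (x, y) |-> f (lambda y) (lambda x).

    Conversely, let [phi] be an involution of D(X, K), let e_x be the idempotent
    (E_xx, 0), and let chi_x be the K-algebra morphism (f, i) |-> f(x, x) from
    D(X, K) to K. The key point is that [phi] permutes the characters chi_x.
    First, phi(e_x) is a nonzero idempotent; a finitary idempotent whose diagonal
    vanishes is zero ([finitary_idem_diag0]), so there is some z with
    chi_z(phi(e_x)) = 1. Second, the corner e_x D e_x is spanned by e_x and an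
    element of square zero, so chi_x is the only character which is 1 at e_x
    ([character_eq_chi]). Since K is commutative, chi_z o phi is a character,
    hence chi_z o phi = chi_x; put lambda x := z. As phi o phi = id and
    x |-> chi_x is injective, lambda is an involution of the set X.

    It reverses the order: for x <= y, put d := (E_xy, 0). The entry at (x, y) of
    the first component of phi(e_(lambda x)) d phi(e_(lambda y)) is
    chi_x(phi(e_(lambda x))) chi_y(phi(e_(lambda y))) = 1, so this product and
    its image e_(lambda y) phi(d) e_(lambda x) under [phi] are nonzero, which
    forces lambda y <= lambda x. This avoids showing that idempotents of
    D(X, K) are conjugate to diagonal ones. *)

(** * Diagonal idempotents and characters of D(X, K) *)

Section MatrixUnits.
Context {K : fieldType} {d : Order.disp_t} {X : porderType d}.
Local Notation I := (incspace K X).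
Local Notation FI := (fincalg K X).
Local Notation D := (idealization K X).
Implicit Types (x y z u v : X) (f g i : I) (a b : D).

(** The matrix unit at (x, y); it is 0 unless x <= y. *)
Definition munit_fun x y : X -> X -> K :=
  fun u v => [&& (x <= y)%O, u == x & v == y]%:R.

Lemma munit_incident x y : munit_fun x y \in incident_pred.
Proof.
apply/incidentP => u v; rewrite /munit_fun => uv.
by case: and3P => // -[xy /eqP ux /eqP vy]; rewrite ux vy xy in uv.
Qed.

Definition munit_inc x y : I := IncSpace (munit_incident x y).

Lemma munit_finitary x y : munit_inc x y \in finitary_pred.
Proof.
apply/asboolP => u v _; apply: (@sub_finite_set _ _ [set (x, y)]) => //.
move=> [r s] /= [_ _ _ _]; rewrite /munit_fun.
by case: and3P => // -[_ /eqP-> /eqP->].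
Qed.

Definition munit x y : FI := FIncAlg (munit_finitary x y).

Lemma conv_munitl x y f u v :
  conv (munit x y) f u v = ((x <= y)%O && (u == x))%:R * f y v.
Proof.
rewrite (@convE _ _ _ _ _ _ _ [set y]) ?incfunP //.
  by rewrite fsbig_set1 /= /munit_fun eqxx andbT.
move=> z /=; rewrite /munit_fun; case: and3P => [[_ _ /eqP->]//|_].
by rewrite mul0r eqxx.
Qed.

Lemma conv_munitr x y f u v :
  conv f (munit x y) u v = f u x * ((x <= y)%O && (v == y))%:R.
Proof.
rewrite (@convE _ _ _ _ _ _ _ [set x]) ?incfunP //.
  by rewrite fsbig_set1 /= /munit_fun eqxx.
move=> z /=; rewrite /munit_fun; case: and3P => [[_ /eqP-> _]//|_].
by rewrite mulr0 eqxx.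
Qed.

Lemma conv_diag f g x : conv f g x x = f x x * g x x.
Proof.
rewrite (@convE _ _ _ _ _ _ _ [set x]) ?incfunP ?fsbig_set1 //.
move=> z; rewrite mulf_eq0 negb_or => /andP[].
move=> /(incident_neq0 (incfunP f)) xz /(incident_neq0 (incfunP g)) zx.
by apply/le_anti; rewrite xz zx.
Qed.

(** If p is idempotent with zero diagonal and p(x, y) <> 0, then p(x, z) <> 0 for
    some z < y; iterating this contradicts finitariness. *)
Lemma finitary_idem_diag0 (p : FI) :
  p * p = p -> (forall x, p x x = 0) -> p = 0.
Proof.
move=> pp p0; apply: fincalgP => x y; apply/eqP/negPn/negP => /= pxy.
have descend w : p x w != 0 -> exists2 z, p x z != 0 & (z < w)%O.
  have -> : p x w = conv p p x w by rewrite -{1}pp.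
  move=> /(fsbigN1 (f := fun _ : unit => fun z => p x z * p z w) (x := tt))[z].
  move=> /= _; rewrite mulf_eq0 negb_or => /andP[pxz pzw]; exists z => //.
  rewrite lt_neqAle (incident_neq0 (incfunP p) pzw) andbT.
  by apply: contraNneq pzw => ->; rewrite p0.
have [s sE] : exists s : seq X, [set z | p x z != 0 /\ (z <= y)%O] = [set` s].
  by apply/finite_seqP; apply: (finitary_lfinite (incfunP p) (fincP p)).
have {sE} : forall z, p x z != 0 -> (z <= y)%O -> z \in s.
  move=> z pz zy; suff : [set` s] z by [].
  by rewrite -sE.
(* The finite sequence s contains all z <= y with p(x, z) <> 0, and y may be
   removed from it when passing to some z < y. *)
elim: {s}(size s) {-2}s (leqnn (size s)) y pxy => [|n IH] s ss y pxy sP.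
  by have := sP y pxy (lexx y); case: s ss {sP}.
have [z pxz zy] := descend y pxy.
apply: (IH (rem y s) _ z pxz) => [|t pxt tz].
  by rewrite size_rem ?sP //; case: (size s) ss.
have ty := le_lt_trans tz zy.
have /perm_mem/(_ t) := perm_to_rem (sP y pxy (lexx y)).
by rewrite sP ?(ltW ty) // inE (lt_eqF ty) /= => /esym.
Qed.

(** The diagonal idempotent e_x of D(X, K). *)
Definition didem x : D := (munit x x, 0).

(** The character (f, i) |-> f(x, x) of D(X, K). *)
Definition chi x (a : D) : K := a.1 x x.

Lemma chiM x a b : chi x (a * b) = chi x a * chi x b.
Proof. exact: conv_diag. Qed.

Lemma chi_didem x y : chi x (didem y) = (x == y)%:R.
Proof. by rewrite /chi /= /munit_fun lexx /= andbb. Qed.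

Lemma didem_idem x : didem x * didem x = didem x.
Proof.
apply: (congr2 pair); last by rewrite /= inc_lact0 inc_ract0 addr0.
apply: fincalgP => u v; rewrite [LHS]conv_munitl /= /munit_fun lexx eqxx.
by rewrite /= -natrM mulnb.
Qed.

Lemma inc_lact0l i : inc_lact (0 : FI) i = 0.
Proof. by apply: (addrI (inc_lact 0 i)); rewrite -inc_lactDl !addr0. Qed.

Lemma inc_ract0r i : inc_ract i (0 : FI) = 0.
Proof. by apply: (addrI (inc_ract i 0)); rewrite -inc_ractDr !addr0. Qed.

Lemma ideal_mul_snd a b : (a * b).2 = inc_lact a.1 b.2 + inc_ract a.2 b.1.
Proof. by []. Qed.

Lemma corner1 x y a u v :
  (didem x * a * didem y).1 u v = ((u == x) && (v == y))%:R * a.1 x y.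
Proof.
rewrite [LHS]conv_munitr [X in X * _]conv_munitl !lexx /=.
by rewrite mulrAC -natrM mulnb.
Qed.

Lemma corner2 x y a u v :
  (didem x * a * didem y).2 u v = ((u == x) && (v == y))%:R * a.2 x y.
Proof.
rewrite ideal_mul_snd inc_lact0 add0r ideal_mul_snd inc_ract0 addr0.
rewrite [LHS]conv_munitr [X in X * _]conv_munitl !lexx /=.
by rewrite mulrAC -natrM mulnb.
Qed.

Lemma corner_neq0 x y a : didem x * a * didem y != 0 -> (x <= y)%O.
Proof.
move=> cN0; apply: contraNT cN0 => xy; apply/eqP/(congr2 pair).
  apply: fincalgP => u v; rewrite corner1.
  by rewrite (incidentP _ (incfunP _)) ?mulr0.
apply: incspaceP => u v; rewrite corner2.
by rewrite (incidentP _ (incfunP _)) ?mulr0.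
Qed.

(** The corner e_x D e_x is spanned by e_x and the element (0, E_xx), of square
    zero. *)
Lemma corner_dual x a :
  exists2 n : D, didem x * a * didem x = chi x a *: didem x + n & n * n = 0.
Proof.
exists (0, (didem x * a * didem x).2); last first.
  apply: (congr2 pair); first exact: mul0r.
  by rewrite inc_lact0l inc_ract0r addr0.
apply: (congr2 pair); last by rewrite /= scaler0 add0r.
apply: fincalgP => u v; rewrite corner1 addr0 /= /munit_fun lexx /=.
by rewrite mulrC.
Qed.

(** The only character of D(X, K) with value 1 at e_x is chi_x. *)
Lemma character_eq_chi (psi : D -> K) x : linear_for *%R psi ->
    (forall a b, psi (a * b) = psi a * psi b) -> psi (didem x) = 1 ->
  psi =1 chi x.
Proof.
move=> psil psiM psi1 a; have [n cE nn] := corner_dual x a.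
have psi0 : psi 0 = 0.
  by have := psil (-1) 0 0; rewrite scaler0 addr0 mulN1r addNr.
have psin : psi n = 0.
  by apply/eqP; rewrite -[_ == 0]orbb -mulf_eq0 -psiM nn psi0.
have : psi (didem x * a * didem x) = psi a by rewrite !psiM psi1 mulr1 mul1r.
by rewrite cE psil psi1 psin mulr1 addr0.
Qed.

Lemma idem_chi_neq0 a : a * a = a -> a != 0 -> exists x, chi x a = 1.
Proof.
case: a => p i pp aN0.
have p2 : p * p = p by exact: (congr1 fst pp).
have i2 : inc_lact p i + inc_ract i p = i by exact: (congr1 snd pp).
have [x px] : exists x, p x x != 0.
  apply: contrapT => /forallNP pd; move/eqP: aN0; apply.
  have p0 : p = 0.
    apply: finitary_idem_diag0 => // x; apply/eqP/negPn/negP; exact: pd.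
  have i0 : i = 0; last by rewrite p0 i0.
  by rewrite -i2 p0 inc_lact0l inc_ract0r addr0.
exists x; apply: (mulfI px); rewrite mulr1.
by rewrite -[in RHS]p2; apply/esym/conv_diag.
Qed.

(** This entry is the only one needed: it shows that the product is nonzero as
    soon as a(x, x) and b(y, y) are. *)
Lemma munit_mul_entry x y a b : (x <= y)%O ->
  (a * (munit x y, 0) * b).1 x y = chi x a * chi y b.
Proof.
move=> xy; rewrite /chi [LHS](_ : _ = conv (a.1 * munit x y) b.1 x y) //.
rewrite (@convE _ _ _ _ _ _ _ [set y]) ?incfunP //.
  by rewrite fsbig_set1 [X in X * _]conv_munitr xy eqxx mulr1.
move=> z /=; rewrite [X in X * _]conv_munitr xy.
by case: (z =P y) => // _; rewrite mulr0 mul0r eqxx.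
Qed.

End MatrixUnits.

(** * From involutions of D(X, K) to involutions of X *)

Section InvolutionOfAlgebra.
Context {K : fieldType} {d : Order.disp_t} {X : porderType d}.
Local Notation D := (idealization K X).
Variable phi : D -> D.
Hypothesis phiI : alg_involution phi.

(** Any z at which phi(e_x) has a nonzero diagonal entry works. *)
Lemma alg_involution_chi x : exists z, forall a, chi z (phi a) = chi x a.
Proof.
have [[phil _ _ phiM] phiK] := phiI.
have phi0 : phi 0 = 0.
  by have := phil (-1) 0 0; rewrite scaler0 addr0 scaleN1r addNr.
have [||z chiz] := @idem_chi_neq0 K d X (phi (didem x)).
- by rewrite -phiM didem_idem.
- apply/eqP => /(congr1 phi); rewrite phiK phi0 => /(congr1 (chi x)) /eqP.
  by rewrite chi_didem eqxx oner_eq0.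
exists z; apply: character_eq_chi => // [k a b|a b].
  by rewrite phil.
by rewrite phiM chiM mulrC.
Qed.

Lemma poset_involution_of_alg : exists lambda : X -> X, poset_involution lambda.
Proof.
have [[phil _ _ phiM] phiK] := phiI.
have [lambda chil] := choice alg_involution_chi.
have phi0 : phi 0 = 0.
  by have := phil (-1) 0 0; rewrite scaler0 addr0 scaleN1r addNr.
have lambdaK : involutive lambda.
  move=> x; have := chi_didem (K := K) (lambda (lambda x)) x.
  rewrite -{1}(phiK (didem x)) !chil chi_didem eqxx.
  by case: eqP => // _ /eqP; rewrite oner_eq0.
have chi1 x : chi x (phi (didem (lambda x))) = 1.
  by rewrite -{1}(lambdaK x) chil chi_didem eqxx.
have lambda_anti x y : (x <= y)%O -> (lambda y <= lambda x)%O.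
  move=> xy; pose m := phi (didem (lambda x)) * (munit x y, 0) *
                       phi (didem (lambda y)).
  apply: (@corner_neq0 K _ _ _ _ (phi (munit x y, 0))).
  have <- : phi m = didem (lambda y) * phi (munit x y, 0) * didem (lambda x).
    by rewrite !phiM !phiK mulrA.
  apply/eqP => /(congr1 phi); rewrite phiK phi0 => m0.
  have := munit_mul_entry (phi (didem (lambda x))) (phi (didem (lambda y))) xy.
  rewrite -/m m0 !chi1 mulr1 => /eqP.
  by rewrite eq_sym oner_eq0.
exists lambda; split => //; first exact: inv_bij.
move=> x y; split; first exact: lambda_anti.
by move=> /lambda_anti; rewrite !lambdaK.
Qed.

End InvolutionOfAlgebra.

(** * From involutions of X to involutions of D(X, K) *)

Section InvolutionOfPoset.
Context {K : fieldType} {d : Order.disp_t} {X : porderType d}.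
Local Notation I := (incspace K X).
Local Notation FI := (fincalg K X).
Local Notation D := (idealization K X).
Variable lambda : X -> X.
Hypothesis lambdaP : poset_involution lambda.

(** Transposition along [lambda]. *)
Definition flip_fun (f : X -> X -> K) : X -> X -> K :=
  fun x y => f (lambda y) (lambda x).

Lemma flip_funK : involutive flip_fun.
Proof.
case: lambdaP => _ _ lK f; apply/funext => x; apply/funext => y.
by rewrite /flip_fun !lK.
Qed.

Lemma flip_conv f g : flip_fun (conv f g) = conv (flip_fun g) (flip_fun f).
Proof.
case: lambdaP => _ le_l lK; apply/funext => x; apply/funext => y.
rewrite /flip_fun /conv.
rewrite (@reindex_fsbig _ _ _ _ _ lambda [set z | (x <= z <= y)%O]) /=.
  by apply: eq_fsbigr => z _; rewrite mulrC.
split=> [z /= /andP[xz zy]|z w _ _ /(congr1 lambda)|z /= /andP[yz zx]].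
- by apply/andP; split; apply/le_l; rewrite !lK.
- by rewrite !lK.
- exists (lambda z); rewrite ?lK //=.
  by apply/andP; split; apply/le_l; rewrite lK.
Qed.

Lemma flip_incident (f : I) : flip_fun f \in incident_pred.
Proof.
case: lambdaP => _ le_l _; apply/incidentP => x y xy.
apply: (incidentP _ (incfunP f)); apply: contra xy; exact: (le_l x y).2.
Qed.

Definition flip_inc (f : I) : I := IncSpace (flip_incident f).

Lemma flip_finitary (f : FI) : flip_inc f \in finitary_pred.
Proof.
case: lambdaP => _ le_l lK; apply/asboolP => x y xy.
have := finite_image (fun uv => (lambda uv.2, lambda uv.1))
  (fincP f ((le_l x y).1 xy)).
apply: sub_finite_set => -[u v] /= [xu uv vy nuv fuv].
exists (lambda v, lambda u); rewrite /= ?lK //.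
split=> //; try exact: (le_l _ _).1.
by move=> /(congr1 lambda); rewrite !lK => vu; apply: nuv.
Qed.

Definition flip_finc (f : FI) : FI := FIncAlg (flip_finitary f).

(** The involution of D(X, K) induced by [lambda]. *)
Definition flip (a : D) : D := (flip_finc a.1, flip_inc a.2).

Lemma flipK : involutive flip.
Proof.
by case=> f i; congr pair; do ?apply: val_inj; exact: flip_funK.
Qed.

Lemma flip_alg_involution : alg_involution flip.
Proof.
split; last exact: flipK; split.
- move=> k a b.
  by apply: (congr2 pair); [apply/val_inj/val_inj | apply: val_inj].
- exact: inv_bij flipK.
- apply: (congr2 pair); [apply: fincalgP | apply: incspaceP] => x y //=.
  case: lambdaP => _ _ lK.
  by rewrite /flip_fun /delta (inj_eq (inv_inj lK)) eq_sym.
- move=> a b; apply: (congr2 pair).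
    by apply/val_inj/val_inj; exact: flip_conv.
  apply: val_inj.
  rewrite -[RHS]/(conv (flip_fun b.1) (flip_fun a.2)
                  + conv (flip_fun b.2) (flip_fun a.1)).
  by rewrite -!flip_conv addrC.
Qed.

End InvolutionOfPoset.

Theorem corollary3p5 (K : fieldType) (d : Order.disp_t) (X : porderType d) :
  (exists phi : idealization K X -> idealization K X, alg_involution phi) <->
  (exists lambda : X -> X, poset_involution lambda).
Proof.
split=> [[phi phiI]|[lambda lambdaP]]; first exact: poset_involution_of_alg phiI.
by exists (flip lambdaP); exact: flip_alg_involution.
Qed.
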